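(* Let $\alpha\in\{1/2,1\}$ and $\beta\in(0,1]$. The function $\rho\mapsto\Lambda_*(\rho,\beta,\alpha)$ is decreasing on $[0,1]$, with \[ \lim_{\rho\to0}\Lambda_*(\rho,\beta,\alpha)=\Lambda_*(0,\beta,\alpha)=1+\sqrt\beta,\qquad \lim_{\rho\to1}\Lambda_*(\rho,\beta,\alpha)=\Lambda_*(1,\beta,\alpha)=0. \] For $\rho\in(0,1)$, $\Lambda_*(\rho,\beta,\alpha)$ is the unique root in $\Lambda$ of \[ P_\gamma\bigl(\Lambda^2;\tfrac12\bigr)-\Lambda\,P_\gamma(\Lambda^2;0)=\frac{\Lambda\rho}{\alpha(1-\rho)}, \] and the left-hand side of this equation is a decreasing function of $\Lambda$.
   Context: For $\gamma>0$, $\gamma_\pm=(1\pm\sqrt\gamma)^2$, the Marčenko–Pastur density is $p_\gamma(t)=\frac{1}{2\pi\gamma t}\sqrt{(\gamma_+-t)(t-\gamma_-)}\mathbf 1_{[\gamma_-,\gamma_+]}(t)$, and $P_\gamma(x;k)=\int_x^{\gamma_+}t^kp_\gamma(t)\,dt$. For $\alpha\in\{1/2,1\}$, \[ \mathbf M(\Lambda;\rho,\tilde\rho,\alpha)=\rho+\tilde\rho-\rho\tilde\rho+(1-\tilde\rho)\Bigl[\rho\Lambda^2+\alpha(1-\rho)\bigl(P_\gamma(\Lambda^2;1)-2\Lambda P_\gamma(\Lambda^2;\tfrac12)+\Lambda^2P_\gamma(\Lambda^2;0)\bigr)\Bigr], \] with $\gamma=(\tilde\rho-\rho\tilde\rho)/(\rho-\rho\tilde\rho)$.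 Here $\tilde\rho=\beta\rho$, so $\gamma=\beta(1-\rho)/(1-\beta\rho)$, and $\Lambda_*(\rho,\beta,\alpha)=\operatorname{argmin}_\Lambda\mathbf M(\Lambda;\rho,\beta\rho,\alpha)$ (at $\rho\in\{0,1\}$ defined by the stated values/limits). *)

(* Defs.v *)
From HB Require Import structures.
From mathcomp Require Import all_boot all_order all_algebra.
From mathcomp Require Import all_classical all_reals all_analysis.
Set Implicit Arguments. Unset Strict Implicit. Unset Printing Implicit Defensive.
Import Order.TTheory GRing.Theory Num.Theory.
Import numFieldNormedType.Exports.
Local Open Scope classical_set_scope.
Local Open Scope ring_scope.

Section MP.
Variable R : realType.

Definition gamma_p (g : R) : R := (1 + Num.sqrt g) ^+ 2.
Definition gamma_m (g : R) : R := (1 - Num.sqrt g) ^+ 2.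

Definition mp_density (g t : R) : R :=
  if (gamma_m g <= t) && (t <= gamma_p g) then
    Num.sqrt ((gamma_p g - t) * (t - gamma_m g)) / (2 * pi * g * t)
  else 0.

(* P_gamma(x;k) = \int_x^{gamma_+} t^k p_gamma(t) dt  (Lebesgue integral over [x, gamma_+];
   t^k is powR, so t^0 = 1 and t^(1/2) = sqrt t for t >= 0). *)
Definition P_MP (g x k : R) : R :=
  Rintegral (@lebesgue_measure R) `[x, gamma_p g]
    (fun t => (t `^ k) * mp_density g t).

Definition gamma_of (r rt : R) : R := (rt - r * rt) / (r - r * rt).

Definition Mfun (L r rt a : R) : R :=
  let g := gamma_of r rt in
  r + rt - r * rt + (1 - rt) *
    (r * L ^+ 2 + a * (1 - r) *
       (P_MP g (L ^+ 2) 1 - 2 * L * P_MP g (L ^+ 2) (1 / 2)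
        + L ^+ 2 * P_MP g (L ^+ 2) 0)).

Definition is_argmin (r b a L : R) : Prop :=
  forall L' : R, Mfun L r (b * r) a <= Mfun L' r (b * r) a.

(* Lambda_*(rho,beta,alpha): the stated values at rho = 0, 1; otherwise the argmin
   (chosen classically; the theorem asserts it exists and is unique). *)
Definition Lambda_star (r b a : R) : R :=
  if r == 0 then 1 + Num.sqrt b
  else if r == 1 then 0
  else xget 0 (fun L => is_argmin r b a L).

(* left-hand side of the root equation, with gamma = beta(1-rho)/(1-beta rho) *)
Definition root_lhs (r b L : R) : R :=
  let g := gamma_of r (b * r) in
  P_MP g (L ^+ 2) (1 / 2) - L * P_MP g (L ^+ 2) 0.

End MP.

(* Main.v *)
(* Since [P(x; 1/2) - L P(x; 0)] at [x = L^2] is the integral of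
   [(sqrt t - L)_+] against the Marchenko-Pastur density [p_g], it is
   nonincreasing in [L], and the equation has exactly one root.  The convex
   function [(sqrt t - L)_+ ^ 2] lies above its tangents, so [M] exceeds its
   value at the root [L] by at least a positive multiple of [(L' - L)^2], which
   makes the root the unique minimizer.

   For the monotonicity in [r], note that the integral of [(sqrt t - L)_+]
   against [p_g] itself need not be monotone in [g], but
   [g p_g(t) = sqrt (4 g - (t - 1 - g)^2) / (2 pi t)] is pointwise
   nondecreasing in [g <= 1].  As [(1 - r) / r = (1 - b r) / (b r) * g] for
   [g = b (1 - r) / (1 - b r)], the equation reads
   [(1 - b r) / (b r) * (g * integral) = L / a], whose left-hand side is
   nonincreasing in [r] because [g] is. *)
Require Import Defs.
From HB Require Import structures.
From mathcomp Require Import all_boot all_order all_algebra.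
From mathcomp Require Import all_classical all_reals all_analysis.
From mathcomp Require Import measurable_realfun ring lra.
Import Order.TTheory GRing.Theory Num.Theory.
Import numFieldNormedType.Exports.
Local Open Scope classical_set_scope.
Local Open Scope ring_scope.

(** * Integrals against the Marchenko-Pastur density *)

Section MarchenkoPastur.
Variable R : realType.
Implicit Types (g t L x k : R) (f : R -> R).
Local Notation mu := (@lebesgue_measure R).
(** For [g <= 1] the part of the support in question lies below [gamma_p g <= 4], so one fixed
    domain allows integrals for different [g] and [L] to be compared. *)
Local Notation D := (`[0, 4]%classic : set R).

Definition mp_num g t : R := Num.sqrt (4 * g - (t - 1 - g) ^+ 2).

Lemma gamma_prod g t : 0 <= g ->
  (gamma_p g - t) * (t - gamma_m g) = 4 * g - (t - 1 - g) ^+ 2.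
Proof.
move=> g0; rewrite /gamma_p /gamma_m; move: (Num.sqrt g) (sqr_sqrtr g0) => s sE; rewrite -sE; ring.
Qed.

Lemma gamma_p_le4 g : g <= 1 -> gamma_p g <= 4.
Proof.
move=> g1; rewrite /gamma_p; have s0 := sqrtr_ge0 g.
have s1 : Num.sqrt g <= 1 by rewrite -sqrtr1 ler_wsqrtr.
nra.
Qed.

(* Outside the support the radicand is nonpositive and [Num.sqrt] returns 0. *)
Lemma mp_densityE g t : 0 <= g ->
  mp_density g t = mp_num g t / (2 * pi * g * t).
Proof.
move=> g0; rewrite /mp_density gamma_prod// -/(mp_num g t).
case: ifPn => // /negP tout; rewrite /mp_num ler0_sqrtr ?mul0r//.
rewrite -gamma_prod// leNgt; apply/negP => pos; apply: tout.
have mp : gamma_m g <= gamma_p g.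
  by rewrite /gamma_p /gamma_m; have := sqrtr_ge0 g; nra.
case: (leP (gamma_m g) t) => h1; case: (leP t (gamma_p g)) => h2 //=; nra.
Qed.

Lemma mp_num_ge0 g t : 0 <= mp_num g t. Proof. exact: sqrtr_ge0. Qed.

(* The radicand is symmetric in [1], [g] and [t]. *)
Lemma mp_num_le_t g t : mp_num g t <= 2 * Num.sqrt t.
Proof.
have -> : 2 = Num.sqrt (2 ^+ 2) :> R by rewrite sqrtr_sqr ger0_norm.
rewrite -sqrtrM ?sqr_ge0// ler_wsqrtr//.
have -> : 4 * g - (t - 1 - g) ^+ 2 = 4 * t - (1 + t - g) ^+ 2 by ring.
by have := sqr_ge0 (1 + t - g); lra.
Qed.

Lemma mp_num_le_g g t : mp_num g t <= 2 * Num.sqrt g.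
Proof.
have -> : 2 = Num.sqrt (2 ^+ 2) :> R by rewrite sqrtr_sqr ger0_norm.
rewrite -sqrtrM ?sqr_ge0// ler_wsqrtr//.
by have := sqr_ge0 (t - 1 - g); lra.
Qed.

(** The two radicands differ by [(g2 - g1) * (2 + 2 * t - g1 - g2)]. *)
Lemma mp_num_homo g1 g2 t : g1 <= g2 -> g2 <= 1 -> 0 <= t ->
  mp_num g1 t <= mp_num g2 t.
Proof. by move=> g12 g21 t0; rewrite /mp_num ler_wsqrtr//; nra. Qed.

Lemma mp_density_ge0 g t : 0 <= g -> 0 <= t -> 0 <= mp_density g t.
Proof.
by move=> g0 t0; rewrite mp_densityE// divr_ge0 ?mp_num_ge0// !mulr_ge0// pi_ge0.
Qed.

(** By [mp_num_le_t] the factor [Num.sqrt t] cancels the singularity of the density at 0, even for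
    [g = 1], where the density grows like the inverse of [Num.sqrt t]. *)
Lemma sqrt_mp_density_le g t : 0 < g -> 0 <= t ->
  Num.sqrt t * mp_density g t <= (pi * g)^-1.
Proof.
move=> g0; rewrite le_eqVlt => /predU1P[<-|t0].
  by rewrite sqrtr0 mul0r invr_ge0 mulr_ge0 ?pi_ge0 ?(ltW g0).
rewrite (mp_densityE _ _ (ltW g0)) mulrA ler_pdivrMr ?mulr_gt0 ?pi_gt0//.
have -> : (pi * g)^-1 * (2 * pi * g * t) = 2 * t.
  by move: (pi) (pi_gt0 R) => q q0; field; rewrite !gt_eqF.
have := mp_num_le_t g t; have := sqrtr_ge0 t; have := sqr_sqrtr (ltW t0).
by move: (Num.sqrt t) => s; nra.
Qed.

Lemma measurable_sqrt : measurable_fun [set: R] (@Num.sqrt R).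
Proof. by apply: nondecreasing_measurable => // x y; exact: ler_wsqrtr. Qed.

Lemma measurable_mp_density g : 0 <= g -> measurable_fun D (mp_density g).
Proof.
move=> g0.
(* On [D] the inverse of [t] is its power of exponent [- 1], also at 0, where both are 0. *)
apply: (eq_measurable_fun (fun t => mp_num g t * ((2 * pi * g)^-1 * t `^ (- 1)))).
  move=> t; rewrite inE/= in_itv/= => /andP[t0 _].
  by rewrite powR_inv1// mp_densityE// -invfM.
apply: (measurable_funS measurableT) => //.
apply: measurable_funM; last first.
  by apply: measurable_funM => //; exact: measurable_powR.
apply: (measurableT_comp measurable_sqrt).
apply: measurable_funB => //; apply: measurable_funX.
by apply: measurable_funB => //; apply: measurable_funB.
Qed.

(** * Integrands dominated by the square root, and linearity *)

Lemma integrable_bounded f : measurable_fun D f ->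
  (exists c, forall t, D t -> `|f t| <= c) -> mu.-integrable D (EFin \o f).
Proof.
move=> mf [c fc]; apply: measurable_bounded_integrable => //.
  by rewrite /= lebesgue_measure_itv/=; case: ifP => _; rewrite ltry.
exists `|c|; split => [|M cM t Dt]; first exact: num_real.
by apply: le_trans (fc _ Dt) _; apply/ltW/(le_lt_trans (ler_norm _)).
Qed.

(** A class of integrands whose product with the density is bounded on [D], hence integrable, for
    every [g > 0]. *)
Definition sqrt_dominated f :=
  measurable_fun [set: R] f /\ exists C, forall t, D t -> `|f t| <= C * Num.sqrt t.

Lemma integrable_mp g f : 0 < g -> sqrt_dominated f ->
  mu.-integrable D (EFin \o (fun t => f t * mp_density g t)).
Proof.
move=> g0 [mf [C fC]]; apply: integrable_bounded.
  apply: measurable_funM; first exact: (measurable_funS measurableT).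
  exact: measurable_mp_density (ltW g0).
exists (`|C| * (pi * g)^-1) => t Dt.
have /andP[t0 _] : 0 <= t <= 4 by move: Dt; rewrite /= in_itv.
have p0 := mp_density_ge0 g t (ltW g0) t0.
rewrite normrM (ger0_norm p0).
apply: (@le_trans _ _ (`|C| * (Num.sqrt t * mp_density g t))).
  rewrite mulrA ler_wpM2r//; apply: le_trans (fC _ Dt) _.
  by rewrite ler_wpM2r ?sqrtr_ge0// ler_norm.
by rewrite ler_wpM2l// sqrt_mp_density_le.
Qed.

Definition mp_int g f : R := Rintegral mu D (fun t => f t * mp_density g t).

Lemma mp_intZ g f c : 0 < g -> sqrt_dominated f ->
  mp_int g (fun t => c * f t) = c * mp_int g f.
Proof.
move=> g0 df; rewrite /mp_int -RintegralZl//; last exact: integrable_mp.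
by apply: eq_Rintegral => t _; rewrite mulrA.
Qed.

Lemma mp_intB g f1 f2 : 0 < g -> sqrt_dominated f1 -> sqrt_dominated f2 ->
  mp_int g (fun t => f1 t - f2 t) = mp_int g f1 - mp_int g f2.
Proof.
move=> g0 df1 df2; rewrite /mp_int -RintegralB//; try exact: integrable_mp.
by apply: eq_Rintegral => t _; rewrite mulrBl.
Qed.

Lemma mp_intD g f1 f2 : 0 < g -> sqrt_dominated f1 -> sqrt_dominated f2 ->
  mp_int g (fun t => f1 t + f2 t) = mp_int g f1 + mp_int g f2.
Proof.
move=> g0 df1 df2; rewrite /mp_int -RintegralD//; try exact: integrable_mp.
by apply: eq_Rintegral => t _; rewrite mulrDl.
Qed.

Lemma le_mp_int g f1 f2 : 0 < g -> sqrt_dominated f1 -> sqrt_dominated f2 ->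
  (forall t, D t -> f1 t <= f2 t) -> mp_int g f1 <= mp_int g f2.
Proof.
move=> g0 df1 df2 f12; apply: le_Rintegral => //; try exact: integrable_mp.
move=> t Dt; rewrite ler_wpM2r ?f12//; apply: mp_density_ge0; first exact: ltW.
by move: Dt; rewrite /= in_itv => /andP[].
Qed.

Lemma sqrt_dominatedZ f c : sqrt_dominated f -> sqrt_dominated (fun t => c * f t).
Proof.
move=> [mf [C fC]]; split; first exact: measurable_funM.
by exists (`|c| * C) => t Dt; rewrite normrM -mulrA ler_wpM2l// fC.
Qed.

Lemma sqrt_dominatedB f1 f2 : sqrt_dominated f1 -> sqrt_dominated f2 ->
  sqrt_dominated (fun t => f1 t - f2 t).
Proof.
move=> [mf1 [C1 f1C]] [mf2 [C2 f2C]]; split; first exact: measurable_funB.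
exists (C1 + C2) => t Dt; rewrite mulrDl; apply: le_trans (ler_normB _ _) _.
by rewrite lerD ?f1C ?f2C.
Qed.

Lemma mp_density_out g t : 0 <= g -> gamma_p g < t -> mp_density g t = 0.
Proof. by move=> g0 gt; rewrite /mp_density (leNgt t) gt andbF. Qed.

(** The density vanishes beyond [gamma_p g], so the lower limit [x] can move into the integrand and
    the domain becomes [D]. *)
Lemma P_MPE g x k : 0 < g <= 1 -> 0 <= x ->
  P_MP g x k = mp_int g (fun t => if x <= t then t `^ k else 0).
Proof.
move=> /andP[g0 g1] x0; have g4 := gamma_p_le4 g g1.
rewrite /P_MP /mp_int Rintegral_mkcond [RHS]Rintegral_mkcond.
congr (Rintegral _ _ _); apply/funext => t; rewrite !patchE !mem_setE !in_itv /=.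
case: (leP x t) => xt /=; last by rewrite mul0r if_same.
rewrite (le_trans x0 xt)/=; case: (leP t (gamma_p g)) => tg.
  by rewrite (le_trans tg g4).
by rewrite (mp_density_out _ _ (ltW g0) tg) mulr0 if_same.
Qed.

Lemma le_two_sqrt t : D t -> t <= 2 * Num.sqrt t.
Proof.
rewrite /= in_itv/= => /andP[t0 t4].
have := sqr_sqrtr t0; have := sqrtr_ge0 t; move: (Num.sqrt t) => s s0 sE.
have s2 : s <= 2 by rewrite leNgt; apply/negP; nra.
nra.
Qed.

Lemma sqr_le_sqrt L t : 0 <= L -> 0 <= t -> (L ^+ 2 <= t) = (L <= Num.sqrt t).
Proof.
by move=> L0 t0; rewrite -{1}(sqr_sqrtr t0) ler_sqr ?nnegrE ?sqrtr_ge0.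
Qed.

Lemma measurable_cut x f : measurable_fun [set: R] f ->
  measurable_fun [set: R] (fun t => if x <= t then f t else 0).
Proof. by move=> mf; apply: measurable_fun_ifT => //; exact: measurable_fun_ler. Qed.

Lemma sqrt_dominated_cut C x f : measurable_fun [set: R] f -> 0 <= C ->
  (forall t, D t -> x <= t -> `|f t| <= C * Num.sqrt t) ->
  sqrt_dominated (fun t => if x <= t then f t else 0).
Proof.
move=> mf C0 fC; split; first exact: measurable_cut.
exists C => t Dt; case: ifPn => xt; first exact: fC.
by rewrite normr0 mulr_ge0 ?sqrtr_ge0.
Qed.

Lemma sqrt_dominated_cut1 x :
  sqrt_dominated (fun t => if x <= t then t `^ 1 else 0).
Proof.
apply: (@sqrt_dominated_cut 2) => //.
move=> t Dt _; have /andP[t0 _] : 0 <= t <= 4 by move: Dt; rewrite /= in_itv.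
by rewrite powRr1// ger0_norm// le_two_sqrt.
Qed.

Lemma sqrt_dominated_cut12 x :
  sqrt_dominated (fun t => if x <= t then t `^ (1 / 2) else 0).
Proof.
apply: (@sqrt_dominated_cut 1) => //.
move=> t Dt _; have /andP[t0 _] : 0 <= t <= 4 by move: Dt; rewrite /= in_itv.
by rewrite mul1r powR12_sqrt// mul1r ger0_norm// sqrtr_ge0.
Qed.

Lemma sqrt_dominated_cst L : 0 <= L ->
  sqrt_dominated (fun t => if L ^+ 2 <= t then L else 0).
Proof.
move=> L0; apply: (@sqrt_dominated_cut 1) => //.
move=> t Dt; have /andP[t0 _] : 0 <= t <= 4 by move: Dt; rewrite /= in_itv.
by rewrite sqr_le_sqrt// ger0_norm// mul1r.
Qed.

(* At [L = 0] and [g = 1] the density is unbounded near 0; the factor [L] makes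
   the integrand dominated by [Num.sqrt]. *)
Lemma mul_P_MP0 g L : 0 < g <= 1 -> 0 <= L ->
  L * P_MP g (L ^+ 2) 0 = mp_int g (fun t => if L ^+ 2 <= t then L else 0).
Proof.
move=> g01; rewrite le_eqVlt => /predU1P[<-|L0].
  rewrite mul0r /mp_int (@eq_Rintegral _ _ _ _ _ (fun=> 0)) ?Rintegral_cst ?mul0r//.
  by move=> t _; rewrite if_same mul0r.
rewrite P_MPE ?sqr_ge0// -mp_intZ//; [|by case/andP: g01|].
  congr mp_int; apply/funext => t.
  by case: ifP => _; rewrite ?powRr0 ?mulr1 ?mulr0.
apply: (@sqrt_dominated_cut L^-1) => [||t Dt].
- by [].
- by rewrite invr_ge0 ltW.
have /andP[t0 _] : 0 <= t <= 4 by move: Dt; rewrite /= in_itv.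
rewrite sqr_le_sqrt// ?(ltW L0)// => Lt.
by rewrite powRr0 normr1 mulrC ler_pdivlMr// mul1r.
Qed.

(** * The positive part of [Num.sqrt t - L] and its integrals *)

Definition excess L t : R := Num.max (Num.sqrt t - L) 0.
Definition mp_excess g L : R := mp_int g (excess L).

Lemma excess_ge0 L t : 0 <= excess L t.
Proof. by rewrite /excess le_max lexx orbT. Qed.

Lemma excess_le L t : 0 <= L -> excess L t <= Num.sqrt t.
Proof. by move=> L0; rewrite /excess ge_max sqrtr_ge0 andbT; lra. Qed.

Lemma measurable_excess L : measurable_fun [set: R] (excess L).
Proof.
apply: measurable_maxr => //; apply: measurable_funB => //.
exact: measurable_sqrt.
Qed.

Lemma sqrt_dominated_excess L : 0 <= L -> sqrt_dominated (excess L).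
Proof.
move=> L0; split; first exact: measurable_excess.
by exists 1 => t _; rewrite mul1r ger0_norm ?excess_ge0 ?excess_le.
Qed.

Lemma sqrt_dominated_excess2 L : 0 <= L ->
  sqrt_dominated (fun t => excess L t ^+ 2).
Proof.
move=> L0; split; first by apply: measurable_funX; exact: measurable_excess.
exists 2 => t Dt; have := le_two_sqrt t Dt; apply: le_trans.
have /andP[t0 _] : 0 <= t <= 4 by move: Dt; rewrite /= in_itv.
rewrite ger0_norm ?sqr_ge0// -{2}(sqr_sqrtr t0) ler_sqr ?nnegrE ?sqrtr_ge0 ?excess_ge0//.
exact: excess_le.
Qed.

Lemma excessE L t : 0 <= L -> 0 <= t ->
  excess L t = if L ^+ 2 <= t then Num.sqrt t - L else 0.
Proof.
move=> L0 t0; rewrite sqr_le_sqrt// /excess.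
case: leP => h; [apply/max_idPl|apply/max_idPr]; lra.
Qed.

Lemma eq_mp_int g f1 f2 : (forall t, 0 <= t -> f1 t = f2 t) ->
  mp_int g f1 = mp_int g f2.
Proof.
move=> f12; apply: eq_Rintegral => t; rewrite inE/= in_itv/= => /andP[t0 _].
by rewrite f12.
Qed.

Lemma P_MP_root g L : 0 < g <= 1 -> 0 <= L ->
  P_MP g (L ^+ 2) (1 / 2) - L * P_MP g (L ^+ 2) 0 = mp_excess g L.
Proof.
move=> g01 L0; have /andP[g0 _] := g01.
rewrite mul_P_MP0// P_MPE ?sqr_ge0// -mp_intB//.
- apply: eq_mp_int => t t0; rewrite excessE//.
  by case: ifP => _; rewrite ?subr0// mul1r powR12_sqrt.
- exact: sqrt_dominated_cut12.
- exact: sqrt_dominated_cst.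
Qed.

(** The three terms come from expanding the square of [Num.sqrt t - L] where [L ^+ 2 <= t]. *)
Lemma P_MP_risk g L : 0 < g <= 1 -> 0 <= L ->
  P_MP g (L ^+ 2) 1 - 2 * L * P_MP g (L ^+ 2) (1 / 2) + L ^+ 2 * P_MP g (L ^+ 2) 0 =
  mp_int g (fun t => excess L t ^+ 2).
Proof.
move=> g01 L0; have /andP[g0 _] := g01.
rewrite expr2 -(mulrA L L) mul_P_MP0// !P_MPE ?mulr_ge0//.
have d1 := sqrt_dominated_cut1 (L * L).
have d2 := sqrt_dominated_cut12 (L * L).
have d3 := sqrt_dominated_cst L L0; rewrite expr2 in d3.
rewrite -!mp_intZ// -mp_intB//; last exact: sqrt_dominatedZ.
rewrite -mp_intD//; last first.
- exact: sqrt_dominatedZ.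
- by apply: sqrt_dominatedB => //; exact: sqrt_dominatedZ.
apply: eq_mp_int => t t0; rewrite excessE// expr2.
case: ifP => _; last by rewrite !mulr0 subrr addr0 expr0n.
rewrite mul1r powR12_sqrt// powRr1// -{1}(sqr_sqrtr t0); ring.
Qed.

Lemma mp_excess_nonincreasing g L1 L2 : 0 < g -> 0 <= L1 -> L1 <= L2 ->
  mp_excess g L2 <= mp_excess g L1.
Proof.
move=> g0 L10 L12; apply: le_mp_int => //.
- exact/sqrt_dominated_excess/(le_trans L10).
- exact: sqrt_dominated_excess.
move=> t _; rewrite /excess ge_max !le_max lexx orbT andbT; apply/orP; left; lra.
Qed.

(** The square root of the right edge [gamma_p g] is [1 + Num.sqrt g]. *)
Lemma mp_excess_eq0 g L : 0 <= g -> 1 + Num.sqrt g <= L -> mp_excess g L = 0.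
Proof.
move=> g0 gL; have s0 := sqrtr_ge0 g.
rewrite /mp_excess /mp_int (@eq_Rintegral _ _ _ _ _ (fun=> 0)) ?Rintegral_cst ?mul0r//.
move=> t; rewrite inE/= in_itv/= => /andP[t0 _].
have [tL|tL] := leP t (gamma_p g); last by rewrite mp_density_out// mulr0.
have tL' : Num.sqrt t <= 1 + Num.sqrt g.
  by rewrite -[leRHS]ger0_norm ?addr_ge0// -sqrtr_sqr ler_wsqrtr.
by rewrite /excess (max_idPr _) ?mul0r//; lra.
Qed.

(** The map from [u] to [Num.max u 0 ^+ 2] is convex with derivative [2 * Num.max u 0]; this is its
    tangent at [Num.sqrt t - L], evaluated at [Num.sqrt t - L']. *)
Lemma excess_sqr_tangent L L' t :
  excess L t ^+ 2 - 2 * (L' - L) * excess L t <= excess L' t ^+ 2.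
Proof.
have -> : L' - L = (Num.sqrt t - L) - (Num.sqrt t - L') by ring.
rewrite /excess; move: (Num.sqrt t - L) (Num.sqrt t - L') => u v.
have := sqr_ge0 (u - v); have := sqr_ge0 v.
by case: (leP u 0) => h; case: (leP v 0) => h' /=; nra.
Qed.

Lemma mp_excess_sqr_tangent g L L' : 0 < g -> 0 <= L -> 0 <= L' ->
  mp_int g (fun t => excess L t ^+ 2) - 2 * (L' - L) * mp_excess g L <=
  mp_int g (fun t => excess L' t ^+ 2).
Proof.
move=> g0 L0 L'0; have d := sqrt_dominated_excess L L0.
have d2 := sqrt_dominated_excess2 L L0.
rewrite -mp_intZ// -mp_intB//; last exact: sqrt_dominatedZ.
apply: le_mp_int => //.
- by apply: sqrt_dominatedB => //; exact: sqrt_dominatedZ.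
- exact: sqrt_dominated_excess2.
by move=> t _; exact: excess_sqr_tangent.
Qed.

(** * Dependence of the integrals on [g] *)

Lemma mulr_mp_density g t : 0 < g ->
  g * mp_density g t = mp_num g t / (2 * pi * t).
Proof.
move=> g0; rewrite mp_densityE ?(ltW g0)//.
rewrite (_ : 2 * pi * g * t = g * (2 * pi * t)); last by ring.
by rewrite invfM mulrCA mulVKf// gt_eqF.
Qed.

Lemma mulr_mp_excess_nondecreasing g1 g2 L : 0 < g1 -> g1 <= g2 -> g2 <= 1 ->
  0 <= L -> g1 * mp_excess g1 L <= g2 * mp_excess g2 L.
Proof.
move=> g10 g12 g21 L0; have g20 : 0 < g2 := lt_le_trans g10 g12.
have di g : 0 < g -> mu.-integrable D
    (EFin \o (fun t => g * excess L t * mp_density g t)).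
  move=> g0; apply: integrable_mp => //; apply: sqrt_dominatedZ.
  exact: sqrt_dominated_excess.
rewrite /mp_excess -!mp_intZ//; try exact: sqrt_dominated_excess.
apply: le_Rintegral => //; [exact: di|exact: di|] => t.
rewrite /= in_itv/= => /andP[t0 _].
rewrite ![_ * excess L t]mulrC -!mulrA !mulr_mp_density//.
rewrite ler_wpM2l ?excess_ge0// ler_wpM2r ?mp_num_homo//.
by rewrite invr_ge0 !mulr_ge0// pi_ge0.
Qed.

Lemma le_mp_int_cst g f c : 0 < g -> sqrt_dominated f ->
  (forall t, 0 <= t -> f t * mp_density g t <= c) -> mp_int g f <= c * 4.
Proof.
move=> g0 df fc; have D4 : fine (mu D) = 4.
  by rewrite lebesgue_measure_itv/= lte_fin ltr0n/= oppr0 addr0.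
have -> : c * 4 = Rintegral mu D (fun=> c) by rewrite Rintegral_cst// D4.
apply: le_Rintegral => //; first exact: integrable_mp.
  by apply: integrable_bounded => //; exists `|c|.
by move=> t; rewrite /= in_itv/= => /andP[t0 _]; exact: fc.
Qed.

(** Since [L * excess L t <= t] cancels the denominator [t], and [mp_num g t <= 2 * Num.sqrt g], the
    integrand is at most [Num.sqrt g / pi]; the domain has length 4. This drives the limit at
    [r = 1]. *)
Lemma mp_excess_le g L : 0 < g -> 0 < L ->
  L * (g * mp_excess g L) <= Num.sqrt g * 4.
Proof.
move=> g0 L0; have d := sqrt_dominated_excess L (ltW L0).
rewrite /mp_excess mulrA -mp_intZ//; apply: le_mp_int_cst => //.
  exact: sqrt_dominatedZ.
move=> t; rewrite le_eqVlt => /predU1P[<-|t0].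
  (* At [t = 0] the density is 0, as [0^-1 = 0]. *)
  by rewrite mp_densityE ?(ltW g0)// mulr0 invr0 !mulr0 sqrtr_ge0.
rewrite -mulrA [_ * mp_density _ _]mulrC -mulrA [_ * excess _ _]mulrC.
rewrite (_ : L * (g * _) = L * excess L t * (g * mp_density g t)); last by ring.
have Lt : L * excess L t <= t.
  rewrite /excess -[leRHS](sqr_sqrtr (ltW t0)); move: (Num.sqrt t) => s.
  by case: (leP (s - L) 0) => h; nra.
have w0 : 0 <= g * mp_density g t by rewrite mulr_ge0 ?mp_density_ge0 ?(ltW g0) ?(ltW t0).
apply: le_trans (ler_wpM2r w0 Lt) _.
rewrite mulr_mp_density// [2 * pi * t]mulrC invfM mulrCA mulVKf ?gt_eqF//.
rewrite ler_pdivrMr ?mulr_gt0 ?pi_gt0//.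
have := mp_num_le_g g t; have := sqrtr_ge0 g; have := pi_ge2 R.
by move: (pi) => p; nra.
Qed.

(** * Positivity, continuity in [L] and existence of a root *)

Lemma mp_excess_gt0 g L : 0 < g <= 1 -> 0 < L -> L < 1 + Num.sqrt g ->
  0 < mp_excess g L.
Proof.
move=> /andP[g0 g1] L0 Lg.
have s0 : 0 < Num.sqrt g by rewrite sqrtr_gt0.
have s1 : Num.sqrt g <= 1 by rewrite -sqrtr1 ler_wsqrtr.
have sE := sqr_sqrtr (ltW g0).
(* The middle third of the gap from [m] to [1 + Num.sqrt g] stays at distance [h] from both ends;
   [m >= 1] also keeps it away from the left edge [1 - Num.sqrt g]. *)
pose m := Num.max L 1; pose h := (1 + Num.sqrt g - m) / 3.
have Lm : L <= m by rewrite le_max lexx.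
have m1 : 1 <= m by rewrite le_max lexx orbT.
have mg : m < 1 + Num.sqrt g by rewrite gt_max Lg; lra.
have h0 : 0 < h by rewrite divr_gt0//; lra.
have hE : m + 3 * h = 1 + Num.sqrt g by rewrite /h; field.
pose u := (m + h) ^+ 2; pose v := (m + 2 * h) ^+ 2.
have uv : u < v by rewrite /u /v; nra.
have u0 : 0 <= u by exact: sqr_ge0.
have v4 : v <= 4 by rewrite /v; nra.
(* One [h] bounds the excess and the other bounds [mp_num g t]; the denominator uses [g <= 1] and
   [t <= 4]. *)
pose c := h * (h / (2 * pi * 4)).
have c0 : 0 < c by rewrite /c mulr_gt0// divr_gt0// !mulr_gt0// pi_gt0.
(* On [`[u, v]] both [Num.sqrt t - L] and [mp_num g t] are at least [h]. *)
have fc t : u <= t -> t <= v -> c <= excess L t * mp_density g t.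
  move=> ut tv; have t0 : 0 <= t := le_trans u0 ut.
  have tE := sqr_sqrtr t0; have t4 : t <= 4 := le_trans tv v4.
  have us : m + h <= Num.sqrt t.
    by rewrite -sqr_le_sqrt//; lra.
  have sv : Num.sqrt t <= m + 2 * h.
    by rewrite -[leRHS]ger0_norm -?sqrtr_sqr ?ler_wsqrtr//; lra.
  have hn : h <= mp_num g t.
    rewrite /mp_num -[leLHS](ger0_norm (ltW h0)) -sqrtr_sqr ler_wsqrtr//.
    rewrite -gamma_prod ?(ltW g0)// /gamma_p /gamma_m -tE.
    (* The radicand splits into two differences, each at least [h], and two sums, each at least
       1. *)
    rewrite !subr_sqr expr2.
    by apply: ler_pM; rewrite ?(ltW h0)// -[leLHS]mulr1; apply: ler_pM; lra.
  have tt : 0 < t by rewrite (lt_le_trans _ ut)// exprn_gt0//; lra.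
  apply: ler_pM => //.
  - exact: ltW.
  - by rewrite divr_ge0 ?(ltW h0)// !mulr_ge0// pi_ge0.
  - by rewrite /excess le_max; apply/orP; left; lra.
  rewrite mp_densityE ?(ltW g0)//; apply: ler_pM; rewrite ?(ltW h0)//.
    by rewrite invr_ge0 !mulr_ge0// pi_ge0.
  rewrite lef_pV2 ?posrE ?mulr_gt0 ?pi_gt0//.
  rewrite -!mulrA ler_pM2l// ler_pM2l ?pi_gt0//; nra.
have D01 : D `&` `[u, v] = `[u, v]%classic.
  apply/setIidPr => t; rewrite /= !in_itv/= => /andP[ut tv].
  by rewrite (le_trans u0 ut) (le_trans tv v4).
pose f t := if (u <= t) && (t <= v) then c else 0.
have fE : Rintegral mu D f = c * (v - u).
  transitivity (Rintegral mu (D `&` `[u, v]) (fun=> c)).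
    rewrite Rintegral_mkcondr; congr (Rintegral _ _ _); apply/funext => t.
    by rewrite patchE mem_setE in_itv.
  by rewrite D01 Rintegral_cst//= lebesgue_measure_itv/= lte_fin uv.
apply: (@lt_le_trans _ _ (Rintegral mu D f)).
  by rewrite fE mulr_gt0// subr_gt0.
apply: le_Rintegral => //.
- apply: integrable_bounded.
    apply: (measurable_funS measurableT) => //.
    apply: measurable_fun_ifT => //.
    by apply: measurable_and; exact: measurable_fun_ler.
  exists c => t _; rewrite /f; case: ifP => _; first by rewrite ger0_norm// ltW.
  by rewrite normr0 ltW.
- by apply: integrable_mp => //; apply: sqrt_dominated_excess; exact: ltW.
move=> t; rewrite /= in_itv/= => /andP[t0 _].
rewrite /f; case: ifP => [/andP[]|_]; first exact: fc.
by rewrite mulr_ge0 ?excess_ge0 ?mp_density_ge0 ?(ltW g0).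
Qed.

(* The bound [L1 >= e > 0] avoids showing that the density has finite mass near 0,
   where it is unbounded for [g = 1]. *)
Lemma mp_excess_lipschitz g e : 0 < g <= 1 -> 0 < e ->
  exists2 C, 0 < C & forall L1 L2, e <= L1 -> L1 <= L2 ->
    mp_excess g L1 - mp_excess g L2 <= C * (L2 - L1).
Proof.
move=> /andP[g0 g1] e0.
(* Below [e ^+ 2] both excesses vanish; above it the excess is 1-Lipschitz in [L]. So the mass above
   [e ^+ 2], which is [e^-1 * mp_int g f], is a Lipschitz constant. *)
pose f t : R := if e ^+ 2 <= t then e else 0.
have df : sqrt_dominated f by apply: sqrt_dominated_cst; exact: ltW.
exists (1 + `|e^-1 * mp_int g f|); first by rewrite ltr_pwDl.
move=> L1 L2 eL1 L12; have L10 : 0 <= L1 by lra.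
have L20 : 0 <= L2 by lra.
apply: (@le_trans _ _ ((L2 - L1) * (e^-1 * mp_int g f))); last first.
  rewrite mulrC; apply: ler_wpM2r; first lra.
  by apply: le_trans (ler_norm _) _; lra.
rewrite mulrA -mp_intZ// /mp_excess -mp_intB//; try exact: sqrt_dominated_excess.
apply: le_mp_int => //.
- by apply: sqrt_dominatedB; exact: sqrt_dominated_excess.
- exact: sqrt_dominatedZ.
move=> t; rewrite /= in_itv/= => /andP[t0 _].
rewrite /f sqr_le_sqrt ?(ltW e0)// /excess; case: ifPn => [et|].
  rewrite -mulrA mulVf ?gt_eqF// mulr1.
  by case: (leP (Num.sqrt t - L1) 0) => h1; case: (leP (Num.sqrt t - L2) 0) => h2; lra.
rewrite -ltNge mulr0 => et.
by rewrite (max_idPr _) ?(max_idPr _); lra.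
Qed.

Lemma mp_excess_root g c : 0 < g <= 1 -> 0 < c ->
  exists2 L, 0 < L & mp_excess g L = c * L.
Proof.
move=> g01 c0; have /andP[g0 g1] := g01.
have s0 : 0 < Num.sqrt g by rewrite sqrtr_gt0.
have G1 : 0 < mp_excess g 1 by apply: mp_excess_gt0 => //; lra.
(* A positive left endpoint at which the excess still dominates:
   [c * e <= mp_excess g 1 <= mp_excess g e]. *)
pose e := Num.min 1 (mp_excess g 1 / c).
have e0 : 0 < e by rewrite lt_min ltr01 divr_gt0.
have e1 : e <= 1 by rewrite ge_min lexx.
have ec : c * e <= mp_excess g e.
  apply: (@le_trans _ _ (mp_excess g 1)); last first.
    by apply: mp_excess_nonincreasing => //; exact: ltW.
  by rewrite mulrC -ler_pdivlMr// ge_min lexx orbT.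
have [C C0 lipC] := mp_excess_lipschitz g e g01 e0.
(* Truncating at [e] makes the Lipschitz bound valid on the whole line, so that [f] is continuous
   everywhere. *)
pose f L := mp_excess g (Num.max e L) - c * L.
have cf : continuous f.
  move=> x; apply: cvgB; last exact: mulrl_continuous.
  apply/cvgrPdist_lt => d d0; near=> y.
  have xy : `|x - y| < d / C.
    by near: y; apply: cvgr_dist_lt; [exact: cvg_id|exact: divr_gt0].
  apply: (@le_lt_trans _ _ (C * `|x - y|)); last by rewrite mulrC -ltr_pdivlMr.
  have lip u v : u <= v ->
      `|mp_excess g (Num.max e u) - mp_excess g (Num.max e v)| <= C * `|u - v|.
    move=> uv; have euv : Num.max e u <= Num.max e v.
      by rewrite ge_max le_max lexx/= le_max uv orbT.
    have em : e <= Num.max e u by rewrite le_max lexx.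
    have em0 := le_trans (ltW e0) em.
    have uvG := mp_excess_nonincreasing g _ _ g0 em0 euv.
    rewrite [leLHS]ger0_norm ?subr_ge0//; apply: (le_trans (lipC _ _ em euv)); rewrite ler_wpM2l ?(ltW C0)//.
    rewrite distrC ger0_norm ?subr_ge0//.
    by case: (leP e u) => h1; case: (leP e v) => h2; lra.
  by case: (leP x y) => [/lip//|/ltW/lip]; rewrite distrC (distrC y).
have [|||L] := @IVT R f e (1 + Num.sqrt g) 0.
- lra.
- exact: continuous_subspaceT.
- rewrite ge_min le_max; apply/andP; split; apply/orP; [right|left].
    rewrite /f (max_idPr _); last lra.
    by rewrite mp_excess_eq0 ?(ltW g0)// sub0r oppr_le0 mulr_ge0 ?(ltW c0)//; lra.
  by rewrite /f maxxx subr_ge0.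
rewrite in_itv/= => /andP[eL _]; rewrite /f (max_idPr eL) => /eqP.
by rewrite subr_eq0 => /eqP LE; exists L => //; exact: lt_le_trans eL.
Unshelve. all: by end_near.
Qed.

(** * The minimizer *)

Section Lambda.
Variables a b : R.
Hypotheses (a0 : 0 < a) (b0 : 0 < b) (b1 : b <= 1).
Implicit Types r : R.
Local Notation gam r := (gamma_of r (b * r)).
Local Notation Lam r := (Lambda_star r b a).

Lemma one_sub_gt0 r : 0 < r < 1 -> 0 < 1 - b * r.
Proof.
move=> /andP[r0 r1]; rewrite subr_gt0; apply: le_lt_trans r1.
by rewrite ler_piMl// ltW.
Qed.

Lemma gammaE r : 0 < r < 1 -> gam r = b * (1 - r) / (1 - b * r).
Proof.
move=> r01; have br := one_sub_gt0 r r01; have /andP[r0 r1] := r01.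
rewrite /gamma_of (_ : r - r * (b * r) = r * (1 - b * r)); last by ring.
rewrite (_ : b * r - r * (b * r) = r * (b * (1 - r))); last by ring.
by rewrite -mulf_div divff ?mul1r// gt_eqF.
Qed.

Lemma gamma_gt0 r : 0 < r < 1 -> 0 < gam r.
Proof.
move=> r01; rewrite gammaE// divr_gt0 ?one_sub_gt0// mulr_gt0//.
by case/andP: r01 => _ r1; rewrite subr_gt0.
Qed.

Lemma gamma_le r : 0 < r < 1 -> gam r <= b.
Proof.
move=> r01; rewrite gammaE// ler_pdivrMr ?one_sub_gt0//; case/andP: r01 => r0 r1.
by rewrite ler_pM2l// lerD2l lerN2 ler_piMl// ltW.
Qed.

Lemma gamma01 r : 0 < r < 1 -> 0 < gam r <= 1.
Proof. by move=> r01; rewrite gamma_gt0//= (le_trans (gamma_le r r01)). Qed.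

Lemma gamma_nonincreasing r1 r2 : 0 < r1 -> r1 <= r2 -> r2 < 1 ->
  gam r2 <= gam r1.
Proof.
move=> r10 r12 r21.
have h1 : 0 < r1 < 1 by rewrite r10 (le_lt_trans r12).
have h2 : 0 < r2 < 1 by rewrite r21 (lt_le_trans r10).
rewrite !gammaE// ler_pdivrMr ?one_sub_gt0// mulrAC ler_pdivlMr ?one_sub_gt0//.
rewrite -!mulrA ler_pM2l// -subr_ge0.
rewrite (_ : _ - _ = (r2 - r1) * (1 - b)); last by ring.
by rewrite mulr_ge0 ?subr_ge0.
Qed.

Definition slope r : R := r / (a * (1 - r)).

Lemma slope_gt0 r : 0 < r < 1 -> 0 < slope r.
Proof. by move=> /andP[r0 r1]; rewrite divr_gt0// mulr_gt0// subr_gt0. Qed.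

Lemma root_lhsE r L : 0 < r < 1 -> 0 <= L ->
  root_lhs r b L = mp_excess (gam r) L.
Proof. by move=> r01 L0; rewrite /root_lhs P_MP_root// gamma01. Qed.

Lemma P_MP_ge0 (g x k : R) : 0 < g <= 1 -> 0 <= x -> 0 <= P_MP g x k.
Proof.
move=> /andP[g0 g1] x0; apply: Rintegral_ge0 => t.
rewrite /= in_itv/= => /andP[xt _].
by rewrite mulr_ge0 ?powR_ge0// mp_density_ge0 ?(ltW g0) ?(le_trans x0).
Qed.

(** For [L' >= 0] a nonincreasing function meets a strictly increasing one at most once; for
    [L' < 0] the left-hand side is nonnegative while the right-hand side is negative. *)
Lemma root_unique r L L' : 0 < r < 1 -> 0 <= L ->
  mp_excess (gam r) L = slope r * L ->
  root_lhs r b L' = L' * r / (a * (1 - r)) -> L' = L.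
Proof.
move=> r01 L0 EL; have s0 := slope_gt0 r r01; have g01 := gamma01 r r01.
have /andP[g0 _] := g01.
rewrite -mulrA -/(slope r) mulrC => EL'; have [L'0|L'0] := ltP L' 0.
  have : 0 <= root_lhs r b L'.
    rewrite /root_lhs/= addr_ge0 ?P_MP_ge0 ?sqr_ge0// -mulNr.
    by rewrite mulr_ge0 ?P_MP_ge0 ?sqr_ge0// oppr_ge0 ltW.
  by rewrite EL' pmulr_rge0// leNgt L'0.
rewrite root_lhsE// in EL'; apply/le_anti/andP; split; rewrite leNgt; apply/negP => h.
- have := mp_excess_nonincreasing _ _ _ g0 L0 (ltW h).
  by rewrite EL EL' ler_pM2l// leNgt h.
- have := mp_excess_nonincreasing _ _ _ g0 L'0 (ltW h).
  by rewrite EL EL' ler_pM2l// leNgt h.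
Qed.

Lemma MfunE r L : 0 < r < 1 -> 0 <= L ->
  Mfun L r (b * r) a = r + b * r - r * (b * r) + (1 - b * r) *
    (r * L ^+ 2 + a * (1 - r) * mp_int (gam r) (fun t => excess L t ^+ 2)).
Proof. by move=> r01 L0; rewrite /Mfun P_MP_risk ?gamma01. Qed.

(** Only the cross term is odd in [L]. This reduces negative arguments to their absolute values. *)
Lemma MfunN r L : Mfun (- L) r (b * r) a = Mfun L r (b * r) a +
  (1 - b * r) * (a * (1 - r)) * (4 * L * P_MP (gam r) (L ^+ 2) (1 / 2)).
Proof. by rewrite /Mfun sqrrN; ring. Qed.

(** At a root the linear term of the tangent becomes [2 * r * L * (L' - L)], and
    [r * L' ^+ 2 - r * L ^+ 2] exceeds it by exactly [r * (L' - L) ^+ 2]. *)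
Lemma Mfun_root r L L' : 0 < r < 1 -> 0 <= L -> 0 <= L' ->
  mp_excess (gam r) L = slope r * L ->
  Mfun L r (b * r) a + (1 - b * r) * r * (L' - L) ^+ 2 <= Mfun L' r (b * r) a.
Proof.
move=> r01 L0 L'0 EL; have br := one_sub_gt0 r r01; have g0 := gamma_gt0 r r01.
have /andP[r0 r1] := r01.
have T := mp_excess_sqr_tangent _ _ _ g0 L0 L'0.
rewrite !MfunE//; move: T; rewrite EL.
move: (mp_int _ _) (mp_int _ _) => I' I T.
have as_ : a * (1 - r) * slope r = r.
  by rewrite /slope mulrC divfK// mulf_neq0 ?gt_eqF// subr_gt0.
have T' : a * (1 - r) * I - 2 * (L' - L) * (r * L) <= a * (1 - r) * I'.
  have -> : r * L = a * (1 - r) * (slope r * L) by rewrite mulrA as_.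
  rewrite (_ : _ - _ = a * (1 - r) * (I - 2 * (L' - L) * (slope r * L))).
    by rewrite ler_pM2l// mulr_gt0// subr_gt0.
  by ring.
have K : r * L ^+ 2 + a * (1 - r) * I + r * (L' - L) ^+ 2 <=
  r * L' ^+ 2 + a * (1 - r) * I' by lra.
by have := ler_wpM2l (ltW br) K; lra.
Qed.

Lemma Lambda_root r : 0 < r < 1 ->
  [/\ 0 < Lam r, mp_excess (gam r) (Lam r) = slope r * Lam r,
      is_argmin r b a (Lam r) & forall L, is_argmin r b a L -> L = Lam r].
Proof.
move=> r01; have br := one_sub_gt0 r r01; have g01 := gamma01 r r01.
have /andP[r0 r1] := r01.
have [L L0 EL] := mp_excess_root _ _ g01 (slope_gt0 r r01).
have c0 : 0 < (1 - b * r) * (a * (1 - r)) by rewrite !mulr_gt0// subr_gt0.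
(* Strict positivity is what rules out [- L] as a second minimizer, through [MfunN]. *)
have P0 : 0 < P_MP (gam r) (L ^+ 2) (1 / 2).
  have := root_lhsE r L r01 (ltW L0); rewrite EL /root_lhs/= => E.
  have := P_MP_ge0 _ (L ^+ 2) 0 g01 (sqr_ge0 L).
  have := mulr_gt0 (slope_gt0 r r01) L0; nra.
have minL L' : Mfun L r (b * r) a + (1 - b * r) * r * (`|L'| - L) ^+ 2 <=
    Mfun L' r (b * r) a.
  have [L'0|L'0] := leP 0 L'; first by rewrite ger0_norm//; exact: (Mfun_root _ _ _ r01 (ltW L0) L'0 EL).
  have nL' : 0 <= - L' by rewrite oppr_ge0 ltW.
  rewrite ltr0_norm//; apply: le_trans (Mfun_root _ _ _ r01 (ltW L0) nL' EL) _.
  rewrite -[X in _ <= Mfun X _ _ _](opprK L') (MfunN r (- L')) lerDl mulr_ge0 ?(ltW c0)//.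
  by rewrite mulr_ge0 ?P_MP_ge0 ?sqr_ge0// mulr_ge0.
have amL : is_argmin r b a L.
  move=> L'; apply: le_trans (minL L'); rewrite lerDl.
  by rewrite mulr_ge0 ?sqr_ge0// mulr_ge0// ltW.
have uL L' : is_argmin r b a L' -> L' = L.
  move=> /(_ L) aL'; have := le_trans (minL L') aL'.
  rewrite gerDl pmulr_rle0 ?mulr_gt0// => sq0.
  have : (`|L'| - L) ^+ 2 == 0 by rewrite eq_le sq0 sqr_ge0.
  rewrite sqrf_eq0 subr_eq0 => /eqP absL'.
  have [L'0|L'0] := leP 0 L'; first by rewrite -absL' ger0_norm.
  have L'E : L' = - L by rewrite -absL' ltr0_norm// opprK.
  move: aL'; rewrite L'E MfunN gerDl leNgt => /negP[].
  by rewrite !mulr_gt0// subr_gt0.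
suff LE : Lam r = L by rewrite LE; split.
rewrite /Lambda_star gt_eqF// lt_eqF//.
by apply: uL; apply: (@xgetI _ _ _ L).
Qed.

(** * Monotonicity in [r] *)

Lemma scaled_root r : 0 < r < 1 ->
  (1 - b * r) / (b * r) * (gam r * mp_excess (gam r) (Lam r)) = Lam r / a.
Proof.
move=> r01; have [_ -> _ _] := Lambda_root r r01.
have br := one_sub_gt0 r r01; have /andP[r0 r1] := r01.
rewrite gammaE// /slope; field.
by rewrite !gt_eqF// subr_gt0.
Qed.

Lemma scaled_excess_nonincreasing r1 r2 L : 0 < r1 -> r1 <= r2 -> r2 < 1 ->
  0 <= L ->
  (1 - b * r2) / (b * r2) * (gam r2 * mp_excess (gam r2) L) <=
  (1 - b * r1) / (b * r1) * (gam r1 * mp_excess (gam r1) L).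
Proof.
move=> r10 r12 r21 L0.
have h1 : 0 < r1 < 1 by rewrite r10 (le_lt_trans r12).
have h2 : 0 < r2 < 1 by rewrite r21 (lt_le_trans r10).
have r20 : 0 < r2 by case/andP: h2.
have o1 := one_sub_gt0 r1 h1; have o2 := one_sub_gt0 r2 h2.
have /andP[g10 g11] := gamma01 r1 h1; have g20 := gamma_gt0 r2 h2.
apply: ler_pM.
- by rewrite divr_ge0 ?mulr_ge0 ?ltW.
- rewrite mulr_ge0 ?(ltW g20)//; apply: Rintegral_ge0 => t.
  rewrite /= in_itv/= => /andP[t0 _].
  by rewrite mulr_ge0 ?excess_ge0 ?mp_density_ge0 ?(ltW g20).
- rewrite ler_pdivrMr ?mulr_gt0// mulrAC ler_pdivlMr ?mulr_gt0// -subr_ge0.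
  rewrite (_ : _ - _ = b * (r2 - r1)); last by ring.
  by rewrite mulr_ge0 ?subr_ge0// ltW.
- by apply: mulr_mp_excess_nondecreasing => //; exact: gamma_nonincreasing.
Qed.

(** As [gam r <= b], the excess vanishes from [1 + Num.sqrt b] on, whereas at the root it equals
    [slope r * Lam r > 0]. *)
Lemma Lambda_lt r : 0 < r < 1 -> Lam r < 1 + Num.sqrt b.
Proof.
move=> r01; have [L0 EL _ _] := Lambda_root r r01.
rewrite ltNge; apply/negP => bL; have g0 := gamma_gt0 r r01.
have : 1 + Num.sqrt (gam r) <= Lam r.
  by apply: le_trans bL; rewrite lerD2l ler_wsqrtr// gamma_le.
move=> /(mp_excess_eq0 _ _ (ltW g0)) E0.
have := mulr_gt0 (slope_gt0 r r01) L0.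
by rewrite -EL E0 ltxx.
Qed.

Lemma Lambda0 : Lam 0 = 1 + Num.sqrt b.
Proof. by rewrite /Lambda_star eqxx. Qed.

Lemma Lambda1 : Lam 1 = 0.
Proof. by rewrite /Lambda_star oner_eq0 eqxx. Qed.

(** If [Lam r1 < Lam r2], lowering first [r2] to [r1] and then [Lam r2] to [Lam r1] does not
    decrease the scaled left-hand side, so [Lam r2 / a <= Lam r1 / a], a contradiction. *)
Lemma Lambda_nonincreasing_oo r1 r2 : 0 < r1 -> r1 <= r2 -> r2 < 1 ->
  Lam r2 <= Lam r1.
Proof.
move=> r10 r12 r21.
have h1 : 0 < r1 < 1 by rewrite r10 (le_lt_trans r12).
have h2 : 0 < r2 < 1 by rewrite r21 (lt_le_trans r10).
have [L10 _ _ _] := Lambda_root r1 h1; have [L20 _ _ _] := Lambda_root r2 h2.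
rewrite leNgt; apply/negP => L12.
have := scaled_excess_nonincreasing r1 r2 (Lam r2) r10 r12 r21 (ltW L20).
rewrite scaled_root// leNgt => /negP; apply.
have c0 : 0 < (1 - b * r1) / (b * r1) by rewrite divr_gt0 ?one_sub_gt0// mulr_gt0.
have G := mp_excess_nonincreasing _ _ _ (gamma_gt0 r1 h1) (ltW L10) (ltW L12).
apply: (le_lt_trans (ler_wpM2l (ltW c0) (ler_wpM2l (ltW (gamma_gt0 r1 h1)) G))).
by rewrite scaled_root// ltr_pM2r ?invr_gt0.
Qed.

Lemma Lambda_nonincreasing r1 r2 : 0 <= r1 -> r1 <= r2 -> r2 <= 1 ->
  Lam r2 <= Lam r1.
Proof.
rewrite le_eqVlt => /predU1P[<-|r10].
  rewrite Lambda0 le_eqVlt => /predU1P[<-|r20]; first by rewrite Lambda0.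
  rewrite le_eqVlt => /predU1P[->|r21].
    by rewrite Lambda1 addr_ge0 ?sqrtr_ge0.
  by rewrite ltW// Lambda_lt// r20.
move=> r12; rewrite le_eqVlt => /predU1P[r2E|r21]; last exact: Lambda_nonincreasing_oo.
move: r12; rewrite r2E le_eqVlt Lambda1 => /predU1P[->|r11].
  by rewrite Lambda1.
by have [L0 _ _ _] := Lambda_root r1 (introT andP (conj r10 r11)); exact: ltW.
Qed.

(** * Limits at 0 and 1 *)

Lemma Lambda_cvg0 : Lam r @[r --> 0^'+] --> 1 + Num.sqrt b.
Proof.
apply/cvgrPdist_lt => e e0.
(* By monotonicity and the upper bound [Lambda_lt], one such [s] controls all smaller [r]. *)
suff [s s01 sL] : exists2 s, 0 < s < 1 & 1 + Num.sqrt b - e < Lam s.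
  have /andP[s0 s1] := s01.
  near=> r; have r0 : 0 < r by near: r; exact: nbhs_right_gt.
  have rs : r < s by near: r; exact: nbhs_right_lt.
  have r01 : 0 < r < 1 by rewrite r0 (lt_trans rs).
  have := Lambda_nonincreasing_oo r s r0 (ltW rs) s1; have := Lambda_lt r r01.
  by move=> h1 h2; rewrite ger0_norm ?subr_ge0 ?(ltW h1)//; lra.
have sb0 : 0 < Num.sqrt b by rewrite sqrtr_gt0.
have sb1 : Num.sqrt b <= 1 by rewrite -sqrtr1 ler_wsqrtr.
have sbE := sqr_sqrtr (ltW b0).
pose d := Num.min e (Num.sqrt b) / 2.
have d0 : 0 < d by rewrite divr_gt0// lt_min e0.
have de : d < e by rewrite ltr_pdivrMr// gt_min; apply/orP; left; lra.
have ds : d < Num.sqrt b by rewrite ltr_pdivrMr// gt_min; apply/orP; right; lra.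
pose L := 1 + Num.sqrt b - d; have L0 : 0 < L by rewrite /L; lra.
have [q q01 qL] : exists2 q, 0 < q < 1 & L < 1 + Num.sqrt (gam q).
  (* With this [q], [gam q >= b * (1 - q) = b - d * Num.sqrt b], which exceeds
     [(Num.sqrt b - d) ^+ 2] because [d < Num.sqrt b]. *)
  pose q := d / Num.sqrt b.
  have q01 : 0 < q < 1 by rewrite divr_gt0//= ltr_pdivrMr// mul1r.
  exists q => //; rewrite /L -addrA ltrD2l.
  have sd0 : 0 <= Num.sqrt b - d by rewrite subr_ge0 ltW.
  rewrite -[ltLHS](ger0_norm sd0) -sqrtr_sqr ltr_sqrt ?gamma_gt0//.
  have /andP[q0 q1] := q01; have oq := one_sub_gt0 q q01.
  apply: (@lt_le_trans _ _ (b * (1 - q))).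
    rewrite mulrBr mulr1 -{2 3}sbE /q mulrCA expr2 mulfK ?gt_eqF//; nra.
  rewrite gammaE// ler_pdivlMr// ler_piMr//; first by rewrite mulr_ge0 ?subr_ge0 ?ltW.
  by rewrite gerBl mulr_ge0 ?ltW.
have /andP[q0 q1] := q01.
pose W := gam q * mp_excess (gam q) L.
have W0 : 0 < W.
  by rewrite mulr_gt0 ?gamma_gt0//; apply: mp_excess_gt0 => //; exact: gamma01.
(* [W] bounds the scaled integral at [L] from below for every parameter up to [q]. The second term
   solves [(1 - b * s) / (b * s) * W > L / a] for [s], the factor 2 making it strict; this excludes
   [Lam s <= L]. *)
pose s := Num.min q (a * W / (2 * (L * b + a * b * W))).
have d20 : 0 < L * b + a * b * W by apply: addr_gt0; [exact: mulr_gt0|apply: mulr_gt0 => //; exact: mulr_gt0].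
have aW0 : 0 < a * W by rewrite mulr_gt0.
have s0 : 0 < s by rewrite lt_min q0/=; apply: divr_gt0 => //; exact: mulr_gt0.
have sq : s <= q by rewrite ge_min lexx.
have s01 : 0 < s < 1 by rewrite s0 (le_lt_trans sq).
have sW : s * (2 * (L * b + a * b * W)) <= a * W.
  by rewrite -ler_pdivlMr ?mulr_gt0// ge_min lexx orbT.
exists s => //; apply: (@lt_trans _ _ L); first by rewrite /L; lra.
have [Ls0 _ _ _] := Lambda_root s s01.
rewrite ltNge; apply/negP => LsL.
have sq' := gamma_nonincreasing s q s0 sq q1.
have /andP[_ gs1] := gamma01 s s01.
have h1 : W <= gam s * mp_excess (gam s) L.
  exact: (mulr_mp_excess_nondecreasing _ _ _ (gamma_gt0 q q01) sq' gs1 (ltW L0)).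
have h2 : gam s * mp_excess (gam s) L <= gam s * mp_excess (gam s) (Lam s).
  rewrite ler_pM2l ?gamma_gt0//.
  exact: (mp_excess_nonincreasing _ _ _ (gamma_gt0 s s01) (ltW Ls0) LsL).
have c0 : 0 < (1 - b * s) / (b * s) by rewrite divr_gt0 ?one_sub_gt0// mulr_gt0.
have : (1 - b * s) / (b * s) * W <= L / a.
  apply: (@le_trans _ _ (Lam s / a)); last by rewrite ler_pM2r// invr_gt0.
  by rewrite -scaled_root// ler_pM2l// (le_trans h1).
rewrite mulrAC ler_pdivrMr ?mulr_gt0// mulrAC ler_pdivlMr// leNgt => /negP; apply.
have := mulr_gt0 s0 d20; lra.
Unshelve. all: by end_near.
Qed.

(** The root equation is multiplied by [Lam r] and bounded by [mp_excess_le]. The factor [1 - b * r]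
    is kept because for [b = 1] the parameter [gam r] stays 1, yet [(1 - b * r) * Num.sqrt (gam r)]
    still tends to 0. *)
Lemma Lambda_sqr_le r : 0 < r < 1 ->
  b * r * Lam r ^+ 2 <= 4 * a * Num.sqrt (1 - r).
Proof.
move=> r01; have [L0 _ _ _] := Lambda_root r r01.
have E := scaled_root r r01; have br := one_sub_gt0 r r01.
have g0 := gamma_gt0 r r01; have /andP[r0 r1] := r01.
have LE : b * r * Lam r = a * ((1 - b * r) * (gam r * mp_excess (gam r) (Lam r))).
  apply: (@mulIf _ (a^-1 * (b * r)^-1)).
    by rewrite mulf_neq0// invr_neq0// ?mulf_neq0// gt_eqF.
  move: E; move: (gam r * _) => W E.
  transitivity (Lam r / a); first by field; rewrite !gt_eqF.
  by rewrite -E; field; rewrite !gt_eqF.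
have -> : b * r * Lam r ^+ 2 =
    a * ((1 - b * r) * (Lam r * (gam r * mp_excess (gam r) (Lam r)))).
  by rewrite expr2 mulrA LE; move: (gam r * _) => W; ring.
have -> : 4 * a * Num.sqrt (1 - r) = a * (4 * Num.sqrt (1 - r)) by ring.
rewrite ler_pM2l//.
have H := mp_excess_le (gam r) (Lam r) g0 L0.
have sg : (1 - b * r) * Num.sqrt (gam r) <= Num.sqrt (1 - r).
  rewrite -[X in X * _](ger0_norm (ltW br)) -sqrtr_sqr -sqrtrM ?sqr_ge0//.
  rewrite ler_wsqrtr// gammaE//.
  have -> : (1 - b * r) ^+ 2 * (b * (1 - r) / (1 - b * r)) =
      b * (1 - b * r) * (1 - r) by field; rewrite gt_eqF.
  have br0 : 0 <= b * r by rewrite mulr_ge0 ?ltW.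
  rewrite ler_piMl ?subr_ge0 ?(ltW r1)// mulr_ile1 ?(ltW b0) ?(ltW br)//.
  by rewrite gerBl.
apply: (@le_trans _ _ ((1 - b * r) * (Num.sqrt (gam r) * 4))).
  by rewrite ler_pM2l.
by rewrite mulrA mulrC ler_pM2l.
Qed.

Lemma Lambda_cvg1 : Lam r @[r --> 1^'-] --> (0 : R).
Proof.
apply/cvgrPdist_lt => e e0.
(* For [r > 1 / 2], [e <= Lam r] would force [c <= Num.sqrt (1 - r)] by [Lambda_sqr_le], which fails
   near 1. *)
pose c := b * e ^+ 2 / (8 * a).
have c0 : 0 < c by rewrite divr_gt0 ?mulr_gt0 ?exprn_gt0.
near=> r.
have rh : 1 / 2 < r by near: r; apply: nbhs_left_gt; lra.
have r1 : r < 1 by near: r; exact: nbhs_left_lt.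
have r01 : 0 < r < 1 by rewrite r1 andbT; lra.
have [L0 _ _ _] := Lambda_root r r01.
have H := Lambda_sqr_le r r01.
rewrite sub0r normrN gtr0_norm// ltNge; apply/negP => eL.
have : 1 - c ^+ 2 < r.
  by near: r; apply: nbhs_left_gt; have := exprn_gt0 2 c0; lra.
apply/negP; rewrite -leNgt lerBrDl -lerBrDr.
have cs : c <= Num.sqrt (1 - r).
  rewrite ler_pdivrMr ?mulr_gt0//.
  have eL2 : e ^+ 2 <= Lam r ^+ 2 by rewrite ler_sqr ?nnegrE ?(ltW e0) ?(ltW L0).
  have : b / 2 * e ^+ 2 <= b * r * Lam r ^+ 2.
    apply: ler_pM => //; [by rewrite divr_ge0 ?mulr_ge0 ?(ltW b0)|exact: sqr_ge0|rewrite ler_pM2l//; lra].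
  by lra.
rewrite -(sqr_sqrtr (_ : 0 <= 1 - r)) ?subr_ge0 ?(ltW r1)//.
by rewrite ler_sqr ?nnegrE ?sqrtr_ge0 ?(ltW c0).
Unshelve. all: by end_near.
Qed.

End Lambda.


End MarchenkoPastur.

Theorem theorem4 (R : realType) (a b : R) :
  (a = 1 / 2 \/ a = 1) -> 0 < b -> b <= 1 ->
  (* for rho in (0,1), Lambda_* is the unique minimizer of M *)
  (forall r : R, 0 < r < 1 ->
     is_argmin r b a (Lambda_star r b a) /\
     (forall L : R, is_argmin r b a L -> L = Lambda_star r b a)) /\
  (* rho |-> Lambda_*(rho) is decreasing (non-increasing) on [0,1] *)
  (forall r1 r2 : R, 0 <= r1 -> r1 <= r2 -> r2 <= 1 ->
     Lambda_star r2 b a <= Lambda_star r1 b a) /\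
  (* limits and endpoint values *)
  (Lambda_star r b a @[r --> 0^'+] --> 1 + Num.sqrt b) /\
  Lambda_star 0 b a = 1 + Num.sqrt b /\
  (Lambda_star r b a @[r --> 1^'-] --> (0 : R)) /\
  Lambda_star 1 b a = 0 /\
  (* root characterization and monotonicity of the left-hand side *)
  (forall r : R, 0 < r < 1 ->
     (forall L : R,
        root_lhs r b L = L * r / (a * (1 - r)) <-> L = Lambda_star r b a) /\
     (forall L1 L2 : R, 0 <= L1 -> L1 <= L2 -> root_lhs r b L2 <= root_lhs r b L1)).
Proof.
move=> aE b0 b1; have a0 : 0 < a by case: aE => ->; rewrite ?divr_gt0.
split; first by move=> r r01; have [_ _ ? ?] := Lambda_root R a b a0 b0 b1 r r01.
split; first exact: Lambda_nonincreasing.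
split; first exact: Lambda_cvg0.
split; first exact: Lambda0.
split; first exact: Lambda_cvg1.
split; first exact: Lambda1.
move=> r r01; have [L0 EL _ _] := Lambda_root R a b a0 b0 b1 r r01; split.
  move=> L; split=> [|->]; first exact: (root_unique R a b a0 b0 b1 _ _ _ r01 (ltW L0) EL).
  by rewrite root_lhsE ?(ltW L0)// EL /slope mulrC mulrA.
move=> L1 L2 L10 L12; rewrite !root_lhsE ?(le_trans L10)//.
by apply: mp_excess_nonincreasing => //; exact: gamma_gt0.
Qed.
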